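(* For all integers $n,k,r,s\geq0$ the modified partial Bell polynomials in the variables $\vec y=(y_1,y_2,\ldots)$ satisfy $$\widetilde{\mathcal{B}}_{n+1,k+1,r}^{(s)}(\vec{y})=\sum_{l=0}^{n-k}\binom{n}{l}y_{l+1}\widetilde{\mathcal{B}}_{n-l,k,r}^{(s)}(\vec{y})+\sum_{l=0}^{n-k}\binom{n}{l}y_{l+s+1}\widetilde{\mathcal{B}}_{n-l,k,r-1}^{(s)}(\vec{y}).$$ Consequently the modified Stirling numbers of the second kind satisfy $$\widetilde{S}(n+1,k+1,r)=\sum_{l=0}^{n-k}\binom{n}{l}\big(\widetilde{S}(n-l,k,r)+\widetilde{S}(n-l,k,r-1)\big),$$ and they are independent of $s$.
   Context: A partition $\lambda$ is a finite weakly decreasing sequence of positive integers $a_1,\dots,a_L$ (the empty partition is allowed), with length $\ell(\lambda)=L$ and $|\lambda|=\sum_l a_l$; $\lambda\vdash N$ means $|\lambda|=N$. For $i\geq1$, $m_i=m_i(\lambda)$ is the number of indices $l$ with $a_l=i$. For $s\geq0$, $\lambda^{>s}$ is the partition obtained by deleting all parts $a_l\leq s$; $(a)_s=\prod_{\upsilon=0}^{s-1}(a-\upsilon)$; $(\mu)_s$ is the sequence obtained by replacing each part $a_l$ of a partition $\mu$ by $(a_l)_s$. $e_r$ of a finite sequence is the $r$th elementary symmetric function of its entries ($e_0=1$; $e_r=0$ if there are fewer than $r$ entries). The modified partial Bell polynomial is $$\widetilde{\mathcal{B}}_{n,k,r}^{(s)}(\vec y)=\sum_{\substack{\lambda \vdash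 n+rs \\ \ell(\lambda)=k \\ \ell(\lambda^{>s}) \geq r}}\frac{n!\,e_{r}\big((\lambda^{>s})_{s}\big)}{\prod_{i\geq1}(i!)^{m_{i}}m_{i}!}\prod_{i\geq1}y_{i}^{m_{i}}$$ for $n,k,r\geq 0$ (it is $0$ unless $r\leq k\leq n$), and it is $0$ by convention for $r=-1$. It is homogeneous of degree $k$, and of weighted degree $n+rs$ when $y_i$ has weight $i$. The modified Stirling number of the second kind $\widetilde{S}(n,k,r)$, a priori depending also on $s$, is the number such that substituting $y_i=c^i x$ for all $i$ turns $\widetilde{\mathcal{B}}_{n,k,r}^{(s)}$ into $c^{n+rs}\,\widetilde{S}(n,k,r)\,x^{k}$; equivalently it is the value of $\widetilde{\mathcal{B}}_{n,k,r}^{(s)}$ at $y_i=1$ for all $i$ (and $\widetilde S(n,k,-1)=0$). Empty sums are $0$. *)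

(* Defs.v *)
From HB Require Import structures.
From mathcomp Require Import all_boot all_order all_algebra finmap.
From mathcomp Require Import monalg.
From mathcomp Require mpoly.

Set Implicit Arguments.
Unset Strict Implicit.
Unset Printing Implicit Defensive.
Import GRing.Theory Num.Theory.
Local Open Scope ring_scope.

Definition is_partition (lam : seq nat) : bool :=
  sorted geq lam && all (leq 1) lam.

(* The partitions of N of length k, each listed once (see mem_partitions and
   partitions_uniq): every part is at most N, hence the tuples over 'I_N.+1. *)
Definition partitions (N k : nat) : seq (seq nat) :=
  [seq lam <- [seq map val (tval t) | t <- enum {: k.-tuple 'I_N.+1}]
     | is_partition lam & sumn lam == N].

Lemma partitions_uniq N k : uniq (partitions N k).
Proof.
rewrite filter_uniq // map_inj_uniq ?enum_uniq //.
by move=> t u /(inj_map val_inj) /val_inj.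
Qed.

Lemma mem_partitions N k lam :
  (lam \in partitions N k) =
    [&& is_partition lam, sumn lam == N & size lam == k].
Proof.
rewrite mem_filter -andbA; case: is_partition => //=.
case: eqP => //= sN; apply/mapP/eqP => [[t _ ->]|sk].
  by rewrite size_map size_tuple.
have lt_lam i : i \in lam -> (i < N.+1)%N.
  by move=> i_lam; rewrite ltnS -sN sumnE (big_rem i) //= leq_addr.
have st : size (map (@inord N) lam) == k by rewrite size_map sk.
exists (Tuple st); rewrite ?mem_enum //= -map_comp.
by rewrite -[LHS]map_id; apply/eq_in_map => i /lt_lam lt_i /=; rewrite inordK.
Qed.

Definition parts_gt (s : nat) (lam : seq nat) : seq nat :=
  [seq a <- lam | (s < a)%N].

Definition ffact_parts (s : nat) (mu : seq nat) : seq nat :=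
  [seq a ^_ s | a <- mu].

Definition elem_sym (r : nat) (a : seq nat) : rat :=
  mpoly.meval (fun i : 'I_(size a) => (tnth (in_tuple a) i)%:R)
    (mpoly.mesym (size a) rat r).

(* The polynomials over rat in the variables y_i, i : nat; y_0 does not occur
   in the Bell polynomials. *)
Notation ypoly := {malg rat[{cmonom nat}]}.

Definition yvar (i : nat) : ypoly := << ucm i >>.

(* For a partition lam all parts are between 1 and sumn lam, so the products
   over i >= 1 can stop at sumn lam: all further factors are 1. *)
Definition bell_denom (lam : seq nat) : nat :=
  (\prod_(1 <= i < (sumn lam).+1)
     (i`! ^ count_mem i lam * (count_mem i lam)`!))%N.

Definition ymonom (lam : seq nat) : ypoly :=
  \prod_(1 <= i < (sumn lam).+1) yvar i ^+ count_mem i lam.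

Definition mbell_nat (s n k r : nat) : ypoly :=
  \sum_(lam <- partitions (n + r * s) k | (r <= size (parts_gt s lam))%N)
    ((n`!)%:R * elem_sym r (ffact_parts s (parts_gt s lam)) / (bell_denom lam)%:R)
      *: ymonom lam.

(* r is an integer because the index r = -1 occurs, where the polynomial is 0
   by convention. *)
Definition mbell (s n k : nat) (r : int) : ypoly :=
  if r is Posz r' then mbell_nat s n k r' else 0.

Definition ymonom_eval (A : comNzRingType) (v : nat -> A) (m : {cmonom nat}) : A :=
  \prod_(i <- finsupp m) v i ^+ m i.

Definition ypoly_eval (A : comAlgType rat) (v : nat -> A) (p : ypoly) : A :=
  mmap (in_alg A) (ymonom_eval v) p.

(* Equivalently, the number S such that substituting y_i := c ^+ i * x turns
   mbell s n k r into c ^+ (n + r * s) * S * x ^+ k: see mbell_subst. *)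
Definition mstirling2 (s n k : nat) (r : int) : rat :=
  ypoly_eval (A := rat^o) (fun=> 1) (mbell s n k r).

Section Evaluation.
Variables (A : comAlgType rat) (v : nat -> A).

Lemma ymonom_evalE (d : {fset nat}) (m : {cmonom nat}) : (finsupp m `<=` d)%fset ->
  ymonom_eval v m = \prod_(i <- d) v i ^+ m i.
Proof.
move=> le; rewrite /ymonom_eval (big_fset_incl _ le) // => i _.
by rewrite -cmE_eq0 => /eqP ->.
Qed.

Lemma ymonom_eval_is_mmorphism : mmorphism (ymonom_eval v).
Proof.
split=> [m1 m2|]; last by rewrite /ymonom_eval mdom1 big_seq_fset0.
have h1 : (finsupp m1 `<=` finsupp (mmul m1 m2 : {cmonom nat}))%fset.
  by rewrite mdomD fsubsetUl.
have h2 : (finsupp m2 `<=` finsupp (mmul m1 m2 : {cmonom nat}))%fset.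
  by rewrite mdomD fsubsetUr.
rewrite (ymonom_evalE h1) (ymonom_evalE h2) -big_split /=.
by apply: eq_bigr => i _; rewrite cmM exprD.
Qed.

HB.instance Definition _ := isMultiplicative.Build _ _ (ymonom_eval v)
  ymonom_eval_is_mmorphism.

Lemma ypoly_evalM p q : ypoly_eval v (p * q) = ypoly_eval v p * ypoly_eval v q.
Proof. exact: rmorphM. Qed.

Lemma ypoly_eval1 : ypoly_eval v 1 = 1.
Proof. exact: rmorph1. Qed.

Lemma ypoly_evalX p n : ypoly_eval v (p ^+ n) = ypoly_eval v p ^+ n.
Proof. exact: rmorphXn. Qed.

Lemma ypoly_eval_sum I (r : seq I) P (F : I -> ypoly) :
  ypoly_eval v (\sum_(i <- r | P i) F i)
  = \sum_(i <- r | P i) ypoly_eval v (F i).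
Proof. exact: raddf_sum. Qed.

Lemma ypoly_evalZ c p : ypoly_eval v (c *: p) = c *: ypoly_eval v p.
Proof. by rewrite /ypoly_eval mmapZ /= mulr_algl. Qed.

Lemma ypoly_eval_var i : ypoly_eval v (yvar i) = v i.
Proof.
rewrite /ypoly_eval mmapU /ymonom_eval mdomU big_seq_fset1 cmUU.
by rewrite /= scale1r mul1r.
Qed.

Lemma ypoly_eval_ymonom lam :
  ypoly_eval v (ymonom lam)
  = \prod_(1 <= i < (sumn lam).+1) v i ^+ count_mem i lam.
Proof.
rewrite /ymonom (big_morph _ ypoly_evalM ypoly_eval1).
by apply: eq_bigr => i _; rewrite ypoly_evalX ypoly_eval_var.
Qed.

End Evaluation.

Lemma prod_count (A : comNzRingType) (v : nat -> A) lam N :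
    all (fun a => 0 < a < N)%N lam ->
  \prod_(1 <= i < N) v i ^+ count_mem i lam = \prod_(i <- lam) v i.
Proof.
elim: lam => [_|a lam IH /= /andP[a_in lam_in]].
  by rewrite big_nil big1.
rewrite big_cons -IH // mulrC.
transitivity (\prod_(1 <= i < N) (v i ^+ count_mem i lam * v i ^+ (a == i))).
  by apply: eq_bigr => i _; rewrite -exprD addnC.
rewrite big_split /=; congr (_ * _).
rewrite (bigD1_seq a) ?iota_uniq ?mem_index_iota //= eqxx expr1.
by rewrite big1 ?mulr1 // => i /negbTE; rewrite eq_sym => ->.
Qed.

Lemma mbell_subst (A : comAlgType rat) (c x : A) (s n k r : nat) :
  ypoly_eval (fun i => c ^+ i * x) (mbell s n k r%:Z)
  = mstirling2 s n k r%:Z *: (c ^+ (n + r * s) * x ^+ k).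
Proof.
rewrite /mstirling2 /= /mbell_nat !ypoly_eval_sum scaler_suml.
rewrite big_seq_cond [RHS]big_seq_cond; apply: eq_bigr => lam /andP[].
rewrite mem_partitions.
move=> /and3P[/andP[_ /allP lam_gt0] /eqP sum_lam /eqP sz_lam] _.
have lam_in : all (fun a => 0 < a < (sumn lam).+1)%N lam.
  apply/allP => a a_lam; rewrite (lam_gt0 a a_lam) /= ltnS sumnE.
  by rewrite (big_rem a) //= leq_addr.
rewrite !ypoly_evalZ !ypoly_eval_ymonom !prod_count // big1_eq.
congr (_ *: _); first by rewrite [RHS]mulr1.
rewrite big_split /= -(big_morph _ (exprD c) (expr0 c)) -sumnE sum_lam.
by rewrite big_const_seq count_predT sz_lam -Monoid.iteropE.
Qed.

(* Main.v *)
(** Write c_a = (a)_s if a > s and c_a = 0 otherwise, so that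
    e_r((lambda^{>s})_s) is the coefficient of X^r in
    P_lambda = prod_(a in lambda) (1 + c_a X).  Multiplying
    P_lambda = (1 + c_a X) P_(lambda \ a) by a, subtracting s c_a X P_(lambda \ a)
    and summing over the parts gives the Euler-type identity
      sum_(a in lambda) (a + (a - s) c_a X) P_(lambda \ a)
        = |lambda| P_lambda - s X P_lambda'.
    In degree r its right-hand side is (|lambda| - r s) e_r, which is (n + 1) e_r
    for lambda |- n + 1 + r s.  The denominators satisfy
    d(lambda) = m_a a! d(lambda \ a), so after division by d(lambda) each distinct
    part a counts once, and (lambda, a) |-> (a, lambda \ a) is a bijection from
    partitions with a chosen part size onto pairs (part size, partition).  The
    terms a P and (a - s) c_a X P, with a = l + 1 and a = l + s + 1, yield the
    two sums of the recurrence. *)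
Require Import Defs.
From mathcomp Require Import all_boot all_order all_algebra finmap.
From mathcomp Require Import monalg.
From mathcomp Require mpoly.
From mathcomp Require Import zify ring.
Set Implicit Arguments.
Unset Strict Implicit.
Unset Printing Implicit Defensive.
Import GRing.Theory Num.Theory.
Local Open Scope ring_scope.

(** * Elementary symmetric functions as polynomial coefficients *)

Section ElemSym.
Import mpoly.

(** Expanding the product chooses the set [J] of factors that contribute their linear term; degree
    [r] keeps the sets of size [r]. *)
Lemma elem_symE (r : nat) (a : seq nat) :
  elem_sym r a = (\prod_(x <- a) (1 + x%:R *: 'X) : {poly rat})`_r.
Proof.
rewrite /elem_sym /mpoly.mesym rmorph_sum /= (big_tnth _ _ a) /=.
under [in RHS]eq_bigr => i _ do rewrite addrC.
rewrite bigA_distr coef_sum [LHS]big_mkcond /=; apply: eq_bigr => J _.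
rewrite -big_mkcond scaler_prod prodr_const coefZ coefXn.
rewrite eq_sym; case: ifP => _; last by rewrite mulr0.
by rewrite mulr1 rmorph_prod; apply: eq_bigr => i _; rewrite /= mpoly.mevalXU.
Qed.

Lemma elem_sym_eq0 (r : nat) (a : seq nat) :
  (size a < r)%N -> elem_sym r a = 0.
Proof. by move=> lt_r; rewrite /elem_sym mesym_geqnE // rmorph0. Qed.

End ElemSym.

(** The c_a above: the value 0 makes the factor of a part [a <= s] equal to 1, which has the effect
    of deleting that part. *)
Definition mark_weight (s a : nat) : rat :=
  if (s < a)%N then (a ^_ s)%:R else 0.

Definition marked_poly (s : nat) (lam : seq nat) : {poly rat} :=
  \prod_(a <- lam) (1 + mark_weight s a *: 'X).

Lemma elem_sym_marked s r lam :
  elem_sym r (ffact_parts s (parts_gt s lam)) = (marked_poly s lam)`_r.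
Proof.
rewrite elem_symE /ffact_parts big_map big_filter big_mkcond /=.
congr (polyseq _)`_r; apply: eq_bigr => a _; rewrite /mark_weight.
by case: ifP => // _; rewrite scale0r addr0.
Qed.

(** * The Euler-type identity *)

Lemma marked_poly_rem s a lam : a \in lam ->
  marked_poly s lam = (1 + mark_weight s a *: 'X) * marked_poly s (rem a lam).
Proof. by move=> a_lam; rewrite /marked_poly (big_rem a). Qed.

Lemma deriv_marked_poly s lam :
  (marked_poly s lam)^`()
  = \sum_(a <- lam) mark_weight s a *: marked_poly s (rem a lam).
Proof.
elim: lam => [|b lam IH]; first by rewrite /marked_poly !big_nil derivC.
rewrite {1}/marked_poly big_cons derivM -/(marked_poly s lam) IH big_cons.
rewrite derivD derivZ derivX derivC add0r alg_polyC mul_polyC /= eqxx.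
congr (_ + _); rewrite mulr_sumr big_seq [RHS]big_seq.
apply: eq_bigr => a a_lam; rewrite -scalerAr; congr (_ *: _).
(* If [a = b], the head is what [rem] deletes, and the factor of [b] restores the copy of [a]
   missing from [rem a lam]. *)
case: eqVneq => [->|_]; first by rewrite -marked_poly_rem.
by rewrite /marked_poly big_cons.
Qed.

Lemma marked_poly_euler s lam :
  \sum_(a <- lam) (a%:R *: marked_poly s (rem a lam)
     + ((a - s)%:R * mark_weight s a) *: ('X * marked_poly s (rem a lam)))
  = (sumn lam)%:R *: marked_poly s lam - s%:R *: ('X * (marked_poly s lam)^`()).
Proof.
rewrite deriv_marked_poly mulr_sumr scaler_sumr sumnE natr_sum scaler_suml.
rewrite -sumrB big_seq [RHS]big_seq; apply: eq_bigr => a a_lam.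
(* Truncation of [a - s] is harmless: for [a <= s] the weight is 0. *)
have -> : (a - s)%:R * mark_weight s a
    = a%:R * mark_weight s a - s%:R * mark_weight s a.
  rewrite /mark_weight; case: ifP => [lt_sa|]; last by rewrite !mulr0 subrr.
  by rewrite natrB 1?ltnW // mulrBl.
rewrite [in RHS](marked_poly_rem _ a_lam) -scalerAr scalerA mulrDl mul1r scalerDr.
by rewrite scalerBl -addrA -scalerAl scalerA.
Qed.

Lemma coef_marked_poly_euler s lam r :
  \sum_(a <- lam) (a%:R * (marked_poly s (rem a lam))`_r
     + (a - s)%:R * mark_weight s a * ('X * marked_poly s (rem a lam))`_r)
  = ((sumn lam)%:R - (r * s)%:R) * (marked_poly s lam)`_r.
Proof.
have /(congr1 (fun p : {poly rat} => p`_r)) := marked_poly_euler s lam.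
rewrite coef_sum coefB !coefZ coefXM => E.
transitivity ((sumn lam)%:R * (marked_poly s lam)`_r
  - s%:R * (if r == 0 then 0 else (marked_poly s lam)^`()`_r.-1)).
  by rewrite -E; apply: eq_bigr => a _; rewrite coefD !coefZ.
rewrite mulrBl; congr (_ - _); case: r {E} => [|r] /=.
  by rewrite mul0n mulr0 mul0r.
by rewrite coef_deriv natrM -mulr_natl; ring.
Qed.

(** A nonzero term in X^r comes from [r] parts of size at least [s + 1]; the other parts are at
    least 1, which forces [sumn lam >= size lam + r * s]. *)
Lemma marked_poly_eq0 s lam r : all (leq 1) lam ->
  (sumn lam < size lam + r * s)%N -> (marked_poly s lam)`_r = 0.
Proof.
elim: lam r => [|b lam IH] r /=.
  rewrite /marked_poly big_nil coef1; case: r => //.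
move=> /andP[b_gt0 lam_gt0] lt_lam.
rewrite /marked_poly big_cons -/(marked_poly s lam) mulrDl mul1r -scalerAl.
rewrite coefD coefZ coefXM IH ?add0r //; last by lia.
case: r lt_lam => [|r] lt_lam /=; first by rewrite mulr0.
rewrite /mark_weight; case: ifP => [lt_sb|]; last by rewrite mul0r.
by rewrite IH ?mulr0 //; move: lt_lam; rewrite mulSn; lia.
Qed.

(** * Removing a part from a partition *)

Lemma partitionsP {N k lam} : lam \in partitions N k ->
  [/\ sorted geq lam, all (leq 1) lam, sumn lam = N & size lam = k].
Proof.
by rewrite mem_partitions => /and3P[/andP[-> ->] /eqP -> /eqP ->].
Qed.

Lemma leq_sumn a lam : a \in lam -> (a <= sumn lam)%N.
Proof. by move=> a_lam; rewrite sumnE (big_rem a) //= leq_addr. Qed.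

Lemma sumn_rem a lam : a \in lam -> sumn lam = (a + sumn (rem a lam))%N.
Proof. by move=> a_lam; rewrite (perm_sumn (perm_to_rem a_lam)). Qed.

(** A sorted list is determined by its multiset, so [rem a] is injective here; its inverse sorts
    [a :: mu]. *)
Lemma perm_partitions_rem N k a : (0 < a <= N)%N ->
  perm_eq [seq rem a lam | lam <- partitions N k.+1 & a \in lam]
          (partitions (N - a) k).
Proof.
move=> /andP[a_gt0 le_aN].
have geq_tr : transitive geq by move=> x y z /= le1 le2; apply: leq_trans le1.
have geq_anti : antisymmetric geq.
  by move=> x y /= /andP[le1 le2]; apply/eqP; rewrite eqn_leq le1 le2.
apply: uniq_perm; [|exact: partitions_uniq|move=> mu].
  rewrite map_inj_in_uniq => [|lam lam']; first exact/filter_uniq/partitions_uniq.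
  rewrite mem_filter => /andP[a_lam /partitionsP[srt _ _ _]].
  rewrite mem_filter => /andP[a_lam' /partitionsP[srt' _ _ _]] eq_rem.
  apply: sorted_eq srt srt' _ => //.
  rewrite (permPl (perm_to_rem a_lam)) eq_rem perm_sym.
  exact: perm_to_rem.
apply/mapP/idP => [[lam]|mu_part].
  rewrite mem_filter => /andP[a_lam /partitionsP[srt pos sN sk]] ->.
  rewrite mem_partitions /is_partition (subseq_sorted geq_tr (rem_subseq _ _)) //.
  rewrite size_rem // sk eqxx -sN (sumn_rem a_lam) addKn eqxx !andbT.
  by apply/allP => i /mem_rem; apply/allP.
have [srt pos sN sk] := partitionsP mu_part.
have perm_lam : perm_eq (sort geq (a :: mu)) (a :: mu) by rewrite perm_sort.
have a_lam : a \in sort geq (a :: mu) by rewrite mem_sort mem_head.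
have srt_lam : sorted geq (sort geq (a :: mu)).
  by apply: sort_sorted => x y; exact: leq_total.
exists (sort geq (a :: mu)).
  rewrite mem_filter a_lam mem_partitions /is_partition srt_lam.
  rewrite (perm_sumn perm_lam) size_sort /= sk sN subnKC // !eqxx !andbT.
  by rewrite (perm_all _ perm_lam) /= a_gt0.
apply: (sorted_eq geq_tr geq_anti) => //.
  by rewrite (subseq_sorted geq_tr (rem_subseq _ _)).
by rewrite -(perm_cons a) -(permPr (perm_to_rem a_lam)) perm_sym.
Qed.

Lemma sum_partitions_rem (V : nmodType) N k (f : nat -> seq nat -> V) :
  \sum_(lam <- partitions N k.+1) \sum_(a <- undup lam) f a (rem a lam)
  = \sum_(1 <= a < N.+1) \sum_(mu <- partitions (N - a) k) f a mu.
Proof.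
transitivity (\sum_(lam <- partitions N k.+1)
    \sum_(1 <= a < N.+1 | a \in lam) f a (rem a lam)).
  rewrite big_seq [RHS]big_seq; apply: eq_bigr => lam /partitionsP[_ pos sN _].
  rewrite -[RHS]big_filter; apply: perm_big; apply: uniq_perm.
  - exact: undup_uniq.
  - exact: filter_uniq (iota_uniq _ _).
  move=> a; rewrite mem_undup mem_filter mem_index_iota ltnS.
  case: (boolP (a \in lam)) => //= a_lam.
  by rewrite (allP pos) // -sN leq_sumn.
rewrite (exchange_big_dep xpredT) //= big_nat [RHS]big_nat.
apply: eq_bigr => a a_in; rewrite -big_filter -[LHS](big_map (rem a) xpredT (f a)).
exact/perm_big/perm_partitions_rem.
Qed.

(** Only the factor of index [a] changes: lowering the multiplicity m by one divides it by m *
    a!. *)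
Lemma bell_denom_rem a lam : (0 < a)%N -> a \in lam ->
  bell_denom lam = (count_mem a lam * (a`! * bell_denom (rem a lam)))%N.
Proof.
move=> a_gt0 a_lam.
have -> : bell_denom (rem a lam) = (\prod_(1 <= i < (sumn lam).+1)
    (i`! ^ count_mem i (rem a lam) * (count_mem i (rem a lam))`!))%N.
  (* The denominator of [rem a lam] stops at its own sum; larger indices are not parts and
     contribute factors 1. *)
  rewrite [RHS](big_cat_nat (n := (sumn (rem a lam)).+1)) //=; last first.
    by rewrite ltnS (sumn_rem a_lam) leq_addl.
  rewrite [X in (_ * X)%N]big_nat [X in (_ * X)%N]big1 ?muln1 // => i /andP[lt_i _].
  have /count_memPn -> // : i \notin rem a lam.
  by apply/negP => /leq_sumn; rewrite leqNgt lt_i.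
have a_in : a \in index_iota 1 (sumn lam).+1.
  by rewrite mem_index_iota a_gt0 ltnS leq_sumn.
rewrite /bell_denom !(bigD1_seq a a_in (iota_uniq _ _)) /= !mulnA.
have [m mE] : exists m, count_mem a lam = m.+1.
  by exists (count_mem a lam).-1; rewrite prednK // -has_count has_pred1.
congr (_ * _)%N.
  by rewrite count_rem a_lam /= eqxx mE subn1 /= expnS factS; lia.
apply: eq_bigr => i ne_ia.
by rewrite count_rem a_lam /= eq_sym (negbTE ne_ia) subn0.
Qed.

Lemma bell_denom_neq0 lam : (bell_denom lam)%:R != 0 :> rat.
Proof.
rewrite pnatr_eq0 -lt0n prodn_gt0 // => i.
by rewrite muln_gt0 expn_gt0 !fact_gt0.
Qed.

Lemma ymonom_prod lam : all (leq 1) lam -> ymonom lam = \prod_(i <- lam) yvar i.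
Proof.
move=> /allP pos; rewrite /ymonom prod_count //; apply/allP => a a_lam.
by rewrite ltnS leq_sumn ?pos.
Qed.

Lemma ymonom_rem a lam : all (leq 1) lam -> a \in lam ->
  ymonom lam = yvar a * ymonom (rem a lam).
Proof.
move=> pos a_lam; rewrite !ymonom_prod //; last first.
  by apply/allP => i /mem_rem; apply/allP.
by rewrite (big_rem a).
Qed.

(** * Bell polynomials without n!, indexed by total weight *)

Definition bell_sum (s N k r : nat) : ypoly :=
  \sum_(lam <- partitions N k)
    ((marked_poly s lam)`_r / (bell_denom lam)%:R) *: ymonom lam.

Lemma bell_sum_eq0 s N k r : (N < k + r * s)%N -> bell_sum s N k r = 0.
Proof.
move=> lt_N; rewrite /bell_sum big_seq big1 // => lam /partitionsP[_ pos sN sk].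
by rewrite marked_poly_eq0 ?sN ?sk // mul0r scale0r.
Qed.

Local Arguments mbell : simpl never.

Lemma mbellE s n k r :
  mbell s n k r%:Z = (n`!)%:R *: bell_sum s (n + r * s) k r.
Proof.
rewrite /mbell /mbell_nat /bell_sum [LHS]big_mkcond [RHS]scaler_sumr.
rewrite big_seq [RHS]big_seq; apply: eq_bigr => lam lam_in.
rewrite elem_sym_marked scalerA mulrA; case: ifPn => // lt_r.
suff -> : (marked_poly s lam)`_r = 0 by rewrite mulr0 mul0r scale0r.
rewrite -elem_sym_marked; apply: elem_sym_eq0.
by rewrite /ffact_parts size_map ltnNge.
Qed.

Lemma bell_sum_rec s N k r :
  (N%:R - (r * s)%:R) *: bell_sum s N k.+1 r
  = \sum_(1 <= a < N.+1) \sum_(mu <- partitions (N - a) k)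
      ((a%:R * (marked_poly s mu)`_r
        + (a - s)%:R * mark_weight s a * ('X * marked_poly s mu)`_r)
       / (a`! * bell_denom mu)%:R) *: (yvar a * ymonom mu).
Proof.
rewrite -sum_partitions_rem scaler_sumr big_seq [RHS]big_seq.
apply: eq_bigr => lam /partitionsP[_ pos <- _].
rewrite scalerA mulrA -coef_marked_poly_euler mulr_suml scaler_suml.
(* Equal parts are grouped; their multiplicity will cancel the factor [count_mem a lam] of the
   denominator. *)
rewrite -[LHS]big_undup_iterop_count big_seq [RHS]big_seq.
apply: eq_bigr => a; rewrite mem_undup => a_lam.
rewrite -/(_ *+ _) -scaler_nat scalerA.
rewrite -(ymonom_rem pos a_lam); apply: (congr1 ( *:%R^~ _)).
have a_gt0 : (0 < a)%N := allP pos a a_lam.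
rewrite (bell_denom_rem a_gt0 a_lam) [in LHS]natrM.
have m_neq0 : (count_mem a lam)%:R != 0 :> rat.
  by rewrite pnatr_eq0 -lt0n -has_count has_pred1.
by rewrite invfM mulrCA mulVKf.
Qed.

(** Binomials arise from n!/l! = C(n,l) (n-l)!. The family [y] is left free to serve both sums of
    the recurrence. *)
Lemma scaled_bell_sum s n k r (y : nat -> ypoly) :
  (n`!)%:R *: (\sum_(0 <= l < n.+1 + r * s)
     (l`!)%:R^-1 *: (y l * bell_sum s (n + r * s - l) k r))
  = \sum_(0 <= l < n.+1 - k) 'C(n, l)%:R *: (y l * mbell s (n - l) k r%:Z).
Proof.
have le_nk : (n.+1 - k <= n.+1 + r * s)%N by lia.
rewrite (big_cat_nat (n := (n.+1 - k)%N)) //= [X in _ + X]big_nat.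
(* For [l >= n.+1 - k] the weight [n + r * s - l] is below [k + r * s]. *)
rewrite [X in _ + X]big1 => [|l /andP[le_l lt_l]]; last first.
  by rewrite bell_sum_eq0 ?mulr0 ?scaler0 //; lia.
rewrite addr0 [LHS]scaler_sumr [LHS]big_nat [RHS]big_nat.
apply: eq_bigr => l /andP[_ lt_l].
have le_ln : (l <= n)%N by rewrite -ltnS (leq_trans lt_l) ?leq_subr.
rewrite mbellE -[in RHS]scalerAr !scalerA -(addnBAC _ le_ln).
apply: (congr1 ( *:%R^~ _)).
have l_neq0 : (l`!)%:R != 0 :> rat by rewrite pnatr_eq0 -lt0n fact_gt0.
by rewrite -(bin_fact le_ln) !natrM [(l`!)%:R * _]mulrC mulrA mulfK.
Qed.

Lemma sum_scale_mul (K : nzRingType) (A : algType K) (I : Type) (t : seq I)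
    (c : K) (y : A) (F : I -> A) :
  \sum_(i <- t) c *: (y * F i) = c *: (y * \sum_(i <- t) F i).
Proof. by rewrite mulr_sumr scaler_sumr. Qed.

(** The coefficient of ['X * marked_poly s mu] is kept unevaluated: it is 0 for [r = 0] and has
    index [r - 1] otherwise. *)
Lemma bell_sum_split s N k r :
  (N%:R - (r * s)%:R) *: bell_sum s N k.+1 r
  = \sum_(1 <= a < N.+1)
      ((a%:R / (a`!)%:R) *: (yvar a * bell_sum s (N - a) k r)
       + ((a - s)%:R * mark_weight s a / (a`!)%:R) *: (yvar a
           * \sum_(mu <- partitions (N - a) k)
               (('X * marked_poly s mu)`_r / (bell_denom mu)%:R) *: ymonom mu)).
Proof.
rewrite bell_sum_rec.
have split_term a mu :
    ((a%:R * (marked_poly s mu)`_r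
        + (a - s)%:R * mark_weight s a * ('X * marked_poly s mu)`_r)
       / (a`! * bell_denom mu)%:R) *: (yvar a * ymonom mu)
  = (a%:R / (a`!)%:R) *: (yvar a
        * (((marked_poly s mu)`_r / (bell_denom mu)%:R) *: ymonom mu))
    + ((a - s)%:R * mark_weight s a / (a`!)%:R) *: (yvar a
        * ((('X * marked_poly s mu)`_r / (bell_denom mu)%:R) *: ymonom mu)).
  rewrite -[X in _ + _ *: X]scalerAr -[X in _ *: X + _]scalerAr.
  rewrite [X in _ = X + _]scalerA [X in _ = _ + X]scalerA -scalerDl natrM invfM.
  by apply: (congr1 ( *:%R^~ _)); ring.
apply: eq_bigr => a _.
apply: etrans (eq_bigr _ (fun mu _ => split_term a mu)) _.
rewrite [LHS]big_split; apply: (congr2 +%R); exact: sum_scale_mul.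
Qed.

Lemma mbell_rec s n k r :
  mbell s n.+1 k.+1 r%:Z
  = \sum_(0 <= l < n.+1 - k)
      'C(n, l)%:R *: (yvar l.+1 * mbell s (n - l) k r%:Z)
    + \sum_(0 <= l < n.+1 - k)
        'C(n, l)%:R *: (yvar (l + s).+1 * mbell s (n - l) k (r%:Z - 1)).
Proof.
rewrite mbellE factS mulnC natrM -scalerA.
(* The factor n + 1 left from (n+1)! is exactly the Euler factor. *)
have -> : n.+1%:R = (n.+1 + r * s)%:R - (r * s)%:R :> rat.
  by rewrite natrD addrK.
rewrite bell_sum_split.
rewrite big_split scalerDr /=; congr (_ + _).
  rewrite -scaled_bell_sum big_add1 /=; apply: (congr1 ( *:%R _)).
  apply: eq_big_nat => l _; rewrite addSn subSS; apply: (congr1 ( *:%R^~ _)).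
  (* With a = l + 1, a/a! = 1/l!. *)
  by rewrite factS natrM invfM mulrA divff ?mul1r ?pnatr_eq0.
(* For [r = 0] both second sums vanish: X P has no constant term, and the index -1 gives 0. *)
case: r => [|r].
  rewrite [RHS]big1 => [|l _]; last by rewrite mulr0 scaler0.
  rewrite big1 ?scaler0 // => a _.
  rewrite big1 ?mulr0 ?scaler0 // => mu _.
  by rewrite coefXM /= mul0r scale0r.
have -> : r.+1%:Z - 1 = r%:Z by rewrite -addn1 PoszD addrK.
rewrite -scaled_bell_sum big_add1 /=; apply: (congr1 ( *:%R _)).
have -> : (n.+1 + r.+1 * s)%N = (n.+1 + r * s + s)%N by rewrite mulSn; lia.
(* The first [s] terms have a <= s, hence weight 0; in the rest a = l + s + 1. *)
rewrite (big_cat_nat (n := s)) ?leq_addl //= [X in X + _]big_nat.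
rewrite [X in X + _]big1 => [|l /andP[_ lt_l]]; last first.
  by rewrite /mark_weight ltnNge lt_l /= mulr0 mul0r scale0r.
rewrite add0r -{1}[s]add0n big_addn addnK.
apply: eq_big_nat => l _.
have -> : (n.+1 + r * s + s - (l + s).+1 = n + r * s - l)%N by lia.
under eq_bigr => mu _ do rewrite coefXM /=.
apply: (congr1 ( *:%R^~ _)).
have lt_sl : (s < (l + s).+1)%N by lia.
have eq_l : ((l + s).+1 - s = l.+1)%N by lia.
(* Since a! = (a)_s (l+1)!, the coefficient (a-s) (a)_s / a! is again 1/l!. *)
rewrite /mark_weight lt_sl eq_l -(ffact_fact (ltnW lt_sl)) eq_l factS.
have fl_neq0 : (l`!)%:R != 0 :> rat by rewrite pnatr_eq0 -lt0n fact_gt0.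
have ff_neq0 : ((l + s).+1 ^_ s)%:R != 0 :> rat.
  by rewrite pnatr_eq0 -lt0n ffact_gt0 ltnW.
have l_neq0 : l.+1%:R != 0 :> rat by rewrite pnatr_eq0.
by rewrite !natrM; field; rewrite fl_neq0 nat1r l_neq0.
Qed.

(** * Modified Stirling numbers *)

Lemma ypoly_eval0 (A : comAlgType rat) (v : nat -> A) : ypoly_eval v 0 = 0.
Proof. exact: raddf0. Qed.

Lemma ypoly_evalD (A : comAlgType rat) (v : nat -> A) p q :
  ypoly_eval v (p + q) = ypoly_eval v p + ypoly_eval v q.
Proof. exact: raddfD. Qed.

Lemma mstirling2_rec s n k r :
  mstirling2 s n.+1 k.+1 r%:Z
  = \sum_(0 <= l < n.+1 - k)
      'C(n, l)%:R * (mstirling2 s (n - l) k r%:Z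
                     + mstirling2 s (n - l) k (r%:Z - 1)).
Proof.
have eval_term c i p : ypoly_eval (A := rat^o) (fun=> 1) (c *: (yvar i * p))
    = c * ypoly_eval (A := rat^o) (fun=> 1) p.
  by rewrite ypoly_evalZ ypoly_evalM ypoly_eval_var mul1r.
rewrite /mstirling2 mbell_rec ypoly_evalD.
under [RHS]eq_bigr => l _ do rewrite mulrDr.
rewrite [RHS]big_split; apply: (congr2 +%R).
  by rewrite ypoly_eval_sum; apply: eq_bigr => l _; exact: eval_term.
by rewrite ypoly_eval_sum; apply: eq_bigr => l _; exact: eval_term.
Qed.

Lemma mstirling2_neg1 s n k : mstirling2 s n k (0%:Z - 1) = 0.
Proof. by rewrite sub0r; exact: (ypoly_eval0 (A := rat^o) (fun=> 1)). Qed.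

Lemma mstirling2_eq0 s n k r : (n < k)%N -> mstirling2 s n k r%:Z = 0.
Proof.
move=> lt_nk; rewrite /mstirling2 mbellE bell_sum_eq0 ?ltn_add2r //.
by rewrite ypoly_evalZ ypoly_eval0 scaler0.
Qed.

Lemma bell_sum_n0 s N r : bell_sum s N 0 r = ((N == 0) && (r == 0))%:R.
Proof.
rewrite /bell_sum; case: (eqVneq N 0) => [->|N_neq0] /=; last first.
  rewrite big_seq big1 // => lam /partitionsP[_ _ sN /size0nil lam0].
  by rewrite -sN lam0 in N_neq0.
have -> : partitions 0 0 = [:: [::]].
  apply: perm_small_eq => //; apply: uniq_perm => //; first exact: partitions_uniq.
  by move=> lam; rewrite mem_partitions inE; case: lam => [|a lam]; rewrite //= !andbF.
rewrite big_seq1 /marked_poly big_nil coef1 /bell_denom /ymonom /= !big_geq //.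
by rewrite divr1 scaler_nat.
Qed.

Lemma mstirling2_n0 s n r : mstirling2 s n 0 r%:Z = ((n == 0) && (r == 0))%:R.
Proof.
rewrite /mstirling2 mbellE bell_sum_n0 ypoly_evalZ addn_eq0 muln_eq0.
case: (eqVneq n 0) => [->|_] /=; last by rewrite ypoly_eval0 scaler0.
case: (eqVneq r 0) => [_|_] /=; first by rewrite ypoly_eval1 scale1r.
by rewrite andbF ypoly_eval0 scaler0.
Qed.

(** Neither the recurrence nor the boundary values at [k = 0], [n < k] and index -1 involve [s]; the
    induction is strong because every [n - l] occurs. *)
Lemma mstirling2_indep s s' n k r :
  mstirling2 s n k r%:Z = mstirling2 s' n k r%:Z.
Proof.
elim/ltn_ind: n k r => n IH [|k] r; first by rewrite !mstirling2_n0.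
case: n IH => [|n] IH; first by rewrite !mstirling2_eq0.
rewrite !mstirling2_rec; apply: eq_big_nat => l _.
have IHl := IH (n - l)%N (leq_subr l n) k.
rewrite IHl; apply: (congr1 ( *%R _)); apply: (congr1 (+%R _)).
case: r => [|r]; last by rewrite -addn1 PoszD addrK; exact: IHl.
by rewrite !(mstirling2_neg1 _ (n - l) k).
Qed.

Theorem mainTheorem5 :
  (forall n k r s : nat,
     mbell s n.+1 k.+1 r%:Z
     = \sum_(0 <= l < n.+1 - k)
         'C(n, l)%:R *: (yvar l.+1 * mbell s (n - l) k r%:Z)
       + \sum_(0 <= l < n.+1 - k)
           'C(n, l)%:R *: (yvar (l + s).+1 * mbell s (n - l) k (r%:Z - 1)))
  /\ (forall n k r s : nat,
        mstirling2 s n.+1 k.+1 r%:Z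
        = \sum_(0 <= l < n.+1 - k)
            'C(n, l)%:R * (mstirling2 s (n - l) k r%:Z
                           + mstirling2 s (n - l) k (r%:Z - 1)))
  /\ (forall n k r s s' : nat,
        mstirling2 s n k r%:Z = mstirling2 s' n k r%:Z).
Proof.
split=> [n k r s|]; first exact: mbell_rec.
by split=> [n k r s|n k r s s']; [exact: mstirling2_rec|exact: mstirling2_indep].
Qed.
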